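(* Let $G$ be a graph with $n$ vertices and $S(G)=3$. Then $$|E(G)|\le\begin{cases}\frac{3}{2}n-2 & \text{if } n \text{ is even},\\ \frac{3}{2}n-\frac{3}{2} & \text{if } n\text{ is odd}.\end{cases}$$ Moreover, for every $n\ge 3$ there is a graph $G$ with $n$ vertices and $S(G)=3$ attaining equality.
   Context: For a finite simple graph $G=(V,E)$ and an injective map $f:V\to\mathbb Z$, let $\sigma(G,f)=\{f(v)+f(w): vw\in E\}$. The sum index of $G$ is $S(G)=\min_{f}|\sigma(G,f)|$ over all injective $f:V\to\mathbb Z$. *)

(* Defs.v *)
From mathcomp Require Import all_boot all_order all_algebra finmap.
From mathcomp Require Import boolp.

Set Implicit Arguments.
Unset Strict Implicit.
Unset Printing Implicit Defensive.

Import Order.TTheory GRing.Theory Num.Theory.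
Local Open Scope ring_scope.

Record sgraph : Type := SGraph {
  vertex :> finType;
  adj : rel vertex;
  adj_sym : symmetric adj;
  adj_irr : irreflexive adj }.

Definition edges (G : sgraph) : {set {set G}} :=
  [set [set p.1; p.2] | p : G * G & adj p.1 p.2].

Definition sums (G : sgraph) (f : G -> int) : {fset int} :=
  [fset (f p.1 + f p.2)%R | p : G * G in [set p : G * G | adj p.1 p.2]]%fset.

Definition sum_count (G : sgraph) (k : nat) : Prop :=
  exists f : G -> int, injective f /\ #|` sums f| = k.

(* An injective labelling exists because G is finite. *)
Lemma sum_count_ex (G : sgraph) : exists k, `[< sum_count G k >].
Proof.
pose f (v : G) : int := (enum_rank v : nat)%:Z.
exists #|` sums f|; apply/asboolP; exists f; split=> // u v [].
by move/ord_inj/enum_rank_inj.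
Qed.

Definition sum_index (G : sgraph) : nat := ex_minn (sum_count_ex G).

Lemma sum_indexP (G : sgraph) (k : nat) :
  sum_index G = k <->
  (exists f : G -> int, injective f /\ #|` sums f| = k) /\
  (forall f : G -> int, injective f -> (k <= #|` sums f|)%N).
Proof.
rewrite /sum_index; case: ex_minnP => m /asboolP [f [injf <-]] minm; split.
  move=> <-; split; first by exists f.
  by move=> g injg; apply: minm; apply/asboolP; exists g.
case=> [[g [injg <-]] ming]; apply/eqP; rewrite eqn_leq ming // andbT.
by apply: minm; apply/asboolP; exists g.
Qed.

Definition edge_bound (n : nat) : rat :=
  if odd n then 3 / 2 * n%:R - 3 / 2 else 3 / 2 * n%:R - 2.

(* Main.v *)
(** Under an injective labelling the edges with a prescribed sum [s] form a
    matching, so there are at most [n./2] of them.  If the matching is perfect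
    then the total of all the labels is [s * n / 2], hence at most one [s] has a
    perfect matching.  Thus [k] sums allow at most [k * (n.-1)./2] edges, plus
    one when [n] is even.  The graph on [0, ..., n-1] joining [i] and [j] when
    [i + j] is [n-2], [n-1] or [n] reaches this bound for [k = 3], and applying
    the bound to its number of edges shows that no labelling has fewer than
    three sums. *)

Require Import Defs.
From mathcomp Require Import all_boot all_order all_algebra finmap.
From mathcomp Require Import zify lra.

Set Implicit Arguments.
Unset Strict Implicit.
Unset Printing Implicit Defensive.

Import Order.TTheory GRing.Theory Num.Theory.
Local Open Scope ring_scope.

Lemma edgesP (G : sgraph) (e : {set G}) :
  reflect (exists u v, adj u v /\ e = [set u; v]) (e \in edges G).
Proof.
apply: (iffP imsetP) => [[[u v]] | [u [v [uv ->]]]].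
  by rewrite inE => uv ->; exists u, v.
by exists (u, v); rewrite ?inE.
Qed.

Lemma adj_neq (G : sgraph) (u v : G) : adj u v -> u != v.
Proof. by apply: contraTneq => ->; rewrite adj_irr. Qed.

Lemma edge_other (G : sgraph) (e : {set G}) (u : G) :
  e \in edges G -> u \in e -> exists2 v, adj u v & e = [set u; v].
Proof.
case/edgesP=> x [y [xy ->]]; rewrite !inE => /orP[]/eqP->; first by exists y.
by exists x; [rewrite adj_sym | rewrite setUC].
Qed.

(** Written as a sum over the set because edges are unordered pairs; sums over disjoint edges then
    combine through [big_trivIset]. *)
Definition label_sum (G : sgraph) (f : G -> int) (e : {set G}) : int :=
  \sum_(v in e) f v.

Lemma label_sum_edge (G : sgraph) (f : G -> int) (u v : G) :
  adj u v -> label_sum f [set u; v] = f u + f v.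
Proof.
by move=> /adj_neq uv; rewrite /label_sum big_setU1 ?big_set1 // inE.
Qed.

Definition sum_class (G : sgraph) (f : G -> int) (s : int) : {set {set G}} :=
  [set e in edges G | label_sum f e == s].

Section SumClass.

Variables (G : sgraph) (f : G -> int).
Hypothesis injf : injective f.

(** Double counting: after exchanging the sums, each edge is counted exactly once, at its own label
    sum. *)
Lemma card_edges_sum_class :
  #|edges G| = (\sum_(s <- sums f) #|sum_class f s|)%N.
Proof.
under eq_bigr => s _ do rewrite -sum1_card big_mkcond.
rewrite exchange_big /= -sum1_card big_mkcond; apply: eq_bigr => e _.
case: (boolP (e \in edges G)) => [eE|/negPf eE]; last first.
  by rewrite big1 // => s _; rewrite inE eE.
have es : label_sum f e \in sums f.
  have /edgesP[u [v [uv ->]]] := eE; rewrite label_sum_edge //.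
  by apply/imfsetP; exists (u, v); rewrite //= inE.
rewrite (big_fsetD1 (label_sum f e)) //= inE eE eqxx /= big_seq big1 ?addn0 //.
move=> s; rewrite !inE => /andP[/negPf se _].
by rewrite eE eq_sym se.
Qed.

(** If two edges of equal sum share [u], their other endpoints have equal labels and coincide by
    injectivity. *)
Lemma trivIset_sum_class (s : int) : trivIset (sum_class f s).
Proof.
apply/trivIsetP => e1 e2; rewrite !inE => /andP[e1E /eqP s1] /andP[e2E /eqP s2].
apply: contraR => /pred0Pn[u /= /andP[u1 u2]].
have [v1 uv1 e1v] := edge_other e1E u1.
have [v2 uv2 e2v] := edge_other e2E u2.
have /addrI/injf v12 : f u + f v1 = f u + f v2.
  by rewrite -!label_sum_edge // -e1v -e2v s1 s2.
by rewrite e1v e2v v12.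
Qed.

Lemma card_cover_sum_class (s : int) :
  #|cover (sum_class f s)| = (#|sum_class f s| * 2)%N.
Proof.
have card2 e : e \in sum_class f s -> #|e| = 2.
  rewrite inE => /andP[/edgesP[u [v [uv ->]]] _].
  by rewrite cards2 adj_neq.
apply: (card_uniform_partition card2).
rewrite /partition eqxx trivIset_sum_class /=.
by apply/negP => /card2; rewrite cards0.
Qed.

Lemma sum_class_bound (s : int) : (#|sum_class f s| * 2 <= #|G|)%N.
Proof. by rewrite -card_cover_sum_class max_card. Qed.

Lemma sum_labels_perfect (s : int) :
  (#|sum_class f s| * 2)%N = #|G| -> \sum_v f v = s *+ #|sum_class f s|.
Proof.
rewrite -card_cover_sum_class => coverT.
have /eqP coverE : cover (sum_class f s) == setT.
  by rewrite eqEcard subsetT cardsT coverT leqnn.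
have -> : \sum_v f v = \sum_(v in cover (sum_class f s)) f v.
  by rewrite coverE; apply: eq_bigl => v; rewrite inE.
rewrite big_trivIset ?trivIset_sum_class //= -sumr_const.
by apply: eq_bigr => e; rewrite inE => /andP[_ /eqP].
Qed.

Lemma perfect_sum_class_uniq (s t : int) : (0 < #|G|)%N ->
  (#|sum_class f s| * 2)%N = #|G| -> (#|sum_class f t| * 2)%N = #|G| -> s = t.
Proof.
move=> G_gt0 ps pt.
have := sum_labels_perfect ps; rewrite (sum_labels_perfect pt).
have -> : #|sum_class f t| = #|sum_class f s|.
  by apply/eqP; rewrite -(eqn_pmul2r (isT : 0 < 2)%N) ps pt.
have class_gt0 : (0 < #|sum_class f s|)%N.
  by rewrite -(ltn_pmul2r (isT : 0 < 2)%N) ps.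
by move/(pmulrnI class_gt0).
Qed.

Lemma card_edges_le :
  (#|edges G| <= #|` sums f| * (#|G|.-1)./2 + ~~ odd #|G|)%N.
Proof.
rewrite card_edges_sum_class.
(* On no vertices every class is perfect, so uniqueness fails; but there all classes are empty. *)
have [G0|G_gt0] := posnP #|G|.
  by rewrite big1 // => s _; have := sum_class_bound s; rewrite G0; case: #|_|.
pose perfect s := ((#|sum_class f s| * 2)%N == #|G|).
(* A matching that misses a vertex has at most [(#|G|.-1)./2] edges, and a perfect one has a single
   edge more. *)
have class_le s : (#|sum_class f s| <= (#|G|.-1)./2 + perfect s)%N.
  have := sum_class_bound s; rewrite /perfect.
  by move: #|sum_class f s| #|G| G_gt0 => c n n_gt0; case: eqP; lia.
apply: leq_trans (leq_sum _ (fun s _ => class_le s)) _.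
rewrite big_split /= big_const_seq iter_addn_0 count_predT mulnC leq_add2l.
have [/hasP[s sS ps]|/hasPn noperf] := boolP (has perfect (sums f)).
  rewrite (big_fsetD1 s) //= big_seq big1 ?addn0.
    by rewrite -(eqP ps) oddM andbF ps.
  move=> t; rewrite !inE => /andP[ts _].
  apply/eqP; rewrite eqb0; apply: contra ts => pt.
  by rewrite (perfect_sum_class_uniq G_gt0 (eqP pt) (eqP ps)).
by rewrite big_seq big1 // => s /noperf/negPf->.
Qed.

End SumClass.

Section BandGraph.

Variable n : nat.

(** The shift by 2 expresses that [i + j] lies between [n - 2] and [n] without truncated
    subtraction. *)
Definition band_adj : rel 'I_n :=
  fun i j => (i != j) && (n <= i + j + 2 <= n + 2)%N.

Lemma band_adj_sym : symmetric band_adj.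
Proof. by move=> i j; rewrite /band_adj eq_sym addnC [(i + j)%N]addnC addnC. Qed.

Lemma band_adj_irr : irreflexive band_adj.
Proof. by move=> i; rewrite /band_adj eqxx. Qed.

Definition band_graph : sgraph := SGraph band_adj_sym band_adj_irr.

Definition band_label (i : band_graph) : int := (nat_of_ord i)%:Z.

Lemma band_label_inj : injective band_label.
Proof. by move=> i j [] /val_inj. Qed.

Lemma card_band_sums : (#|` sums band_label| <= 3)%N.
Proof.
have sub : (sums band_label `<=` [fset n%:Z - 2; n%:Z - 1; n%:Z])%fset.
  apply/fsubsetP => s /imfsetP[[i j] /=]; rewrite inE /= => /andP[_ ij] ->.
  rewrite !inE /band_label; lia.
apply: leq_trans (fsubset_leq_card sub) _.
rewrite !cardfsU !cardfs1; lia.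
Qed.

End BandGraph.

(** Listing endpoints in increasing order lets edges be compared coordinatewise. *)
Lemma ord_pair_inj (n : nat) (a b c d : 'I_n) : (a < b)%N -> (c < d)%N ->
  [set a; b] = [set c; d] -> a = c /\ b = d.
Proof.
move=> ab cd E.
have := set21 a b; have := set22 a b; rewrite E !inE.
have := set21 c d; rewrite -E !inE.
move=> /orP[]/eqP ? /orP[]/eqP ? /orP[]/eqP ?; subst; split=> //; lia.
Qed.

Lemma card_band_edges_ge (n : nat) : (0 < n)%N ->
  (3 * (n.-1)./2 + ~~ odd n <= #|edges (band_graph n)|)%N.
Proof.
(* From here on there are [n.+1] vertices, so the three sums are [n - 1], [n] and [n + 1]. The last
   summand of [T] has one element if [n.+1] is even and none otherwise. *)
case: n => // n _; set m := (n.+1.-1)./2.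
pose T : finType := ('I_3 * 'I_m + 'I_(~~ odd n.+1))%type.
(* [(c, k)] is the [k]-th edge of sum [n - 1 + c], and [inr] the middle edge,
   of sum [n]. *)
pose lo (t : T) : nat :=
  match t with inl (c, k) => (k + (c == 2 :> nat))%N | inr _ => m end.
pose hi (t : T) : nat :=
  match t with inl (c, k) => (n - k - (c == 0 :> nat))%N | inr _ => m.+1 end.
have lohi t :
    [/\ (lo t < hi t)%N, (hi t < n.+1)%N & (n <= lo t + hi t + 1 <= n + 2)%N].
  case: t => [[c k]|k] /=; have := ltn_ord k; last first.
    by rewrite /m /= => k_lt; split; lia.
  have := ltn_ord c; rewrite /m.
  by case: eqP => ?; case: eqP => ? ? ?; split; lia.
(* The sum [lo + hi] determines [c], and then [lo] determines [k]. The middle edge differs from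
   those with [c = 1], which have [lo < m]. *)
have lo_hi_inj t u : lo t = lo u -> hi t = hi u -> t = u.
  case: t => [[[c hc] [k hk]]|[k hk]]; case: u => [[[d hd] [l hl]]|[l hl]] /=.
  - have : (k < m)%N by []. have : (l < m)%N by []. rewrite /m /=.
    move=> hl' hk' e1 e2.
    have [kl cd] : k = l /\ c = d.
      by move: e1 e2; do 4![case: eqP => ?]; lia.
    by subst; congr (inl (_, _)); apply: val_inj.
  - by have : (k < m)%N by []; rewrite /m /=; do 2![case: eqP => ?]; lia.
  - by have : (l < m)%N by []; rewrite /m /=; do 2![case: eqP => ?]; lia.
  - move=> _ _; congr inr; apply: val_inj => /=.
    by move: hk hl; case: (odd n) => //=; lia.
pose edge (t : T) : {set band_graph n.+1} := [set inord (lo t); inord (hi t)].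
have lov t : (inord (lo t) : 'I_n.+1) = lo t :> nat.
  by have [? ? _] := lohi t; rewrite inordK //; lia.
have hiv t : (inord (hi t) : 'I_n.+1) = hi t :> nat.
  by have [? ? _] := lohi t; rewrite inordK.
have edge_inj : injective edge.
  move=> t u /ord_pair_inj[||].
  - by rewrite lov hiv; case: (lohi t).
  - by rewrite lov hiv; case: (lohi u).
  move=> /(congr1 val) /=; rewrite !lov => e1 /(congr1 val) /=.
  by rewrite !hiv; apply: lo_hi_inj.
have <- : #|T| = (3 * m + ~~ odd n.+1)%N by rewrite card_sum card_prod !card_ord.
rewrite -cardsT -(card_imset _ edge_inj); apply: subset_leq_card.
apply/subsetP => _ /imsetP[t _ ->]; apply/edgesP.
exists (inord (lo t)), (inord (hi t)); split=> //=.
rewrite /band_adj -val_eqE /= lov hiv.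
by have [] := lohi t; lia.
Qed.

(** Puts both parity cases into the form of [card_edges_le] with three sums. At [n = 0] the two
    sides are -2 and 1. *)
Lemma edge_boundE (n : nat) : (0 < n)%N ->
  edge_bound n = (3 * (n.-1)./2 + ~~ odd n)%:R.
Proof.
move=> n_gt0; rewrite /edge_bound.
have nE : n%:R = 2 * ((n.-1)./2)%:R + (~~ odd n)%:R + 1 :> rat.
  by rewrite -natrM -natrD natr1; congr _%:R; lia.
by rewrite nE natrD natrM; case: (odd n) => /=; lra.
Qed.

Theorem theorem3p1 :
  (forall (n : nat) (G : sgraph), #|G| = n -> sum_index G = 3%N ->
     (#|edges G|%:R : rat) <= edge_bound n) /\
  (forall n : nat, (3 <= n)%N ->
     exists G : sgraph,
       [/\ #|G| = n, sum_index G = 3%N & (#|edges G|%:R : rat) = edge_bound n]).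
Proof.
split=> [n G <- /sum_indexP[[f [injf f3]] _] | n n_ge3].
  (* Having three sums forces an edge, hence a vertex. *)
  have G_gt0 : (0 < #|G|)%N.
    have /fset0Pn[s /imfsetP[[u v] _ _]] : sums f != fset0.
      by rewrite -cardfs_gt0 f3.
    by apply/card_gt0P; exists u.
  by rewrite edge_boundE // ler_nat -f3 card_edges_le.
have cardG : #|band_graph n| = n by rewrite /= card_ord.
have n_gt0 : (0 < n)%N by lia.
have edges_ge := card_band_edges_ge n_gt0.
have sums_ge f : injective f -> (3 <= #|` @sums (band_graph n) f|)%N.
  move=> /card_edges_le; rewrite cardG => /(leq_trans edges_ge).
  (* Since [n >= 3], the common factor [(n.-1)./2] is positive and cancels. *)
  by rewrite leq_add2r leq_pmul2r //; lia.
have sums3 : #|` sums (@band_label n)| = 3%N.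
  by apply/eqP; rewrite eqn_leq card_band_sums sums_ge //; apply: band_label_inj.
exists (band_graph n); split=> //.
  apply/sum_indexP; split=> //; exists (@band_label n).
  by split=> //; apply: band_label_inj.
rewrite edge_boundE //; congr _%:R; apply/eqP; rewrite eqn_leq edges_ge andbT.
by have := card_edges_le (@band_label_inj n); rewrite sums3 cardG.
Qed.
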